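(* If $x,y,z$ are bounded observables on a $\sigma$-MV-effect algebra $E$, then $x+y=y+x$ and $(x+y)+z=x+(y+z)$. If we set $o:=q_0$ (the question observable corresponding to $0\in E$), then $x+o=x=o+x$.
   Context: An effect algebra is a partial algebra $(E;+,0,1)$ with a partial binary operation $+$ such that for all $a,b,c\in E$: (i) $a+b$ is defined iff $b+a$ is, and then $a+b=b+a$; (ii) $a+b$ and $(a+b)+c$ are defined iff $b+c$ and $a+(b+c)$ are, and then $(a+b)+c=a+(b+c)$; (iii) for each $a$ there is a unique $a'\in E$ with $a+a'=1$; (iv) if $a+1$ is defined then $a=0$. It is partially ordered by $a\le b$ iff $a+c=b$ for some $c\in E$. An MV-effect algebra is an effect algebra that is a lattice under $\le$ and in which $a\wedge b=0$ implies that $a+b$ is defined. A $\sigma$-MV-effect algebra is an MV-effect algebra in which all countable joins and meets exist. An observable on $E$ is a mapping $x:\mathcal B(\mathbb R)\to E$ ($\mathcal B(\mathbb R)$ the Borel $\sigma$-algebra of $\mathbb R$) such that (i) $x(\mathbb R)=1$; (ii) if $A\cap B=\emptyset$ then $x(A)+x(B)$ is defined and $x(A\cup B)=x(A)+x(B)$; (iii) if $A_i\subseteq A_{i+1}$ for each $i$ and $\bigcup_iA_i=A$, then $x(A)=\bigvee_ix(A_i)$. It is bounded if $x([\alpha,\beta])=1$ for some interval $[\alpha,\beta]$. Put $B_x(t):=x((-\infty,t))$, $t\in\mathbb R$; the system $\{B_x(t):t\in\mathbb R\}$ is the spectral resolution of $x$ and determines $x$ uniquely. Sum of bounded observables $x,y$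 on $E$: $x+y$ is the unique bounded observable on $E$ whose spectral resolution is $B_{x+y}(t)=\bigvee_{r\in\mathbb Q}(B_x(r)\wedge B_y(t-r))$, $t\in\mathbb R$. For $a\in E$, the question $q_a$ is the observable with $q_a(A)=1$ if $0,1\in A$; $q_a(A)=a$ if $1\in A$, $0\notin A$; $q_a(A)=a'$ if $0\in A$, $1\notin A$; $q_a(A)=0$ if $0,1\notin A$ ($A\in\mathcal B(\mathbb R)$). *)

(* Defs.v *)
From HB Require Import structures.
From mathcomp Require Import all_boot all_order all_algebra.
From mathcomp Require Import all_classical all_reals all_analysis.

Set Implicit Arguments.
Unset Strict Implicit.
Unset Printing Implicit Defensive.

Import Order.TTheory GRing.Theory Num.Theory.
Local Open Scope classical_set_scope.
Local Open Scope ring_scope.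

(* The partial sum is option-valued: [eadd a b = None] means that a + b is
   undefined.  With [obind], each of [eaddC] and [eaddA] states both that one
   side is defined iff the other is, and that the values then agree.  The order
   is part of the carrier's structure, but [le_eadd] forces it to be the one
   induced by the sum. *)
HB.mixin Record isEffectAlgebra d E of Order.POrder d E := {
  ezero : E;
  eone : E;
  eadd : E -> E -> option E;
  eaddC : forall a b, eadd a b = eadd b a;
  eaddA : forall a b c,
    obind (fun s => eadd s c) (eadd a b) = obind (eadd a) (eadd b c);
  eortho_ex : forall a, exists! a', eadd a a' = Some eone;
  eadd_one : forall a, isSome (eadd a eone) -> a = ezero;
  le_eadd : forall a b : E, (a <= b)%O <-> exists c, eadd a c = Some b
}.

#[short(type="effectAlgebraType")]
HB.structure Definition EffectAlgebra d :=
  { E of Order.POrder d E & isEffectAlgebra d E }.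

HB.mixin Record isMVEffectAlgebra d E of EffectAlgebra d E & Order.Lattice d E
:= {
  eadd_disjoint : forall a b : E,
    (a `&` b)%O = ezero -> isSome (eadd a b)
}.

#[short(type="mvEffectAlgebraType")]
HB.structure Definition MVEffectAlgebra d :=
  { E of EffectAlgebra d E & Order.Lattice d E & isMVEffectAlgebra d E }.

HB.mixin Record isSigmaMVEffectAlgebra d E of MVEffectAlgebra d E := {
  countable_join : forall A : set E, countable A -> supremums A !=set0;
  countable_meet : forall A : set E, countable A -> infimums A !=set0
}.

#[short(type="sigmaMVEffectAlgebraType")]
HB.structure Definition SigmaMVEffectAlgebra d :=
  { E of MVEffectAlgebra d E & isSigmaMVEffectAlgebra d E }.

Definition eortho d (E : effectAlgebraType d) (a : E) : E :=
  sval (cid (eortho_ex a)).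

Section effect_algebra_theory.
Context d (E : effectAlgebraType d).
Implicit Types a b : E.

Lemma eadd_ortho a : eadd a (eortho a) = Some (eone : E).
Proof. by rewrite /eortho; case: cid => b []. Qed.

Lemma eadd_cancel1 a b b' :
  eadd a b = Some (eone : E) -> eadd a b' = Some (eone : E) -> b = b'.
Proof. by case: (eortho_ex a) => c [_ cP] /cP <- /cP <-. Qed.

Lemma eortho_one : eortho (eone : E) = ezero.
Proof. by apply: eadd_one; rewrite eaddC eadd_ortho. Qed.

Lemma eadd_one_zero : eadd (eone : E) ezero = Some (eone : E).
Proof. by rewrite -eortho_one eadd_ortho. Qed.

Lemma eaddx0 a : eadd a ezero = Some a.
Proof.
have := eaddA (eortho a) a (ezero : E).
rewrite [eadd (eortho a) a]eaddC eadd_ortho /= eadd_one_zero.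
case: (eadd a ezero) => [b|] //= /esym ab; congr Some.
by apply: (eadd_cancel1 ab); rewrite eaddC eadd_ortho.
Qed.

Lemma ele0x a : (ezero <= a)%O.
Proof. by apply/le_eadd; exists a; rewrite eaddC eaddx0. Qed.

Lemma elex1 a : (a <= eone)%O.
Proof. by apply/le_eadd; exists (eortho a); rewrite eadd_ortho. Qed.

End effect_algebra_theory.

Structure borel (R : realType) := Borel {
  bset :> set R;
  borel_measurable : measurable bset
}.

Section observables.
Context (R : realType) d (E : effectAlgebraType d).

Record is_observable (x : borel R -> E) : Prop := IsObservable {
  obs_setT : forall A : borel R, A = setT :> set R -> x A = eone;
  obs_add : forall A B C : borel R, A `&` B = set0 -> A `|` B = C ->
    eadd (x A) (x B) = Some (x C);
  obs_sup : forall (F : nat -> borel R) (A : borel R),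
    (forall i, F i `<=` F i.+1) -> \bigcup_i F i = A ->
    supremums (range (fun i => x (F i))) (x A)
}.

Structure observable := Observable {
  obs_fun :> borel R -> E;
  observableP : is_observable obs_fun
}.

HB.instance Definition _ := gen_eqMixin observable.
HB.instance Definition _ := gen_choiceMixin observable.

Definition bounded_observable (x : observable) : Prop :=
  exists alpha beta : R, x (Borel (measurable_itv `[alpha, beta])) = eone.

Definition spectral_resolution (x : observable) (t : R) : E :=
  x (Borel (measurable_itv `]-oo, t[)).

Definition question_fun (a : E) (A : borel R) : E :=
  if 1 \in (A : set R) then (if 0 \in (A : set R) then eone else a)
  else (if 0 \in (A : set R) then eortho a else ezero).

Lemma question_is_observable a : is_observable (question_fun a).
Proof.
split.
- by move=> A AT; rewrite /question_fun AT !in_setT.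
- move=> A B C AB0 ABC.
  have CE (u : R) : (u \in (C : set R)) = (u \in (A : set R)) || (u \in (B : set R)).
    by rewrite -ABC in_setU.
  have DE (u : R) : (u \in (A : set R)) && (u \in (B : set R)) = false.
    by rewrite -in_setI AB0 in_set0.
  rewrite /question_fun !CE; move: (DE 0) (DE 1).
  move: (0 \in (A : set R)) (0 \in (B : set R)) => [] [] //= _;
    move: (1 \in (A : set R)) (1 \in (B : set R)) => [] [] //= _;
    by rewrite ?eaddx0 ?eadd_ortho // eaddC ?eaddx0 ?eadd_ortho.
- move=> F A incF FA.
  have homoF i j : (i <= j)%N -> F i `<=` F j.
    move=> ij; rewrite -(subnKC ij); elim: (j - i)%N => [|n IH].
      by rewrite addn0.
    by rewrite addnS; apply: subset_trans IH (incF _).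
  have FsubA i : F i `<=` A by rewrite -FA => u Fu; exists i.
  have ev (u : R) : exists N, forall n, (N <= n)%N ->
      (u \in (F n : set R)) = (u \in (A : set R)).
    have [uA|uA] := boolP (u \in (A : set R)).
      have : (A : set R) u by rewrite inE in uA.
      rewrite -FA => -[N _ FNu]; exists N => n Nn.
      by rewrite mem_set//; exact: homoF FNu.
    exists 0%N => n _; apply/negbTE; apply: contra uA.
    by rewrite !inE; exact: FsubA.
  have [N0 N0P] := ev 0; have [N1 N1P] := ev 1.
  have qA : question_fun a (F (maxn N0 N1)) = question_fun a A.
    by rewrite /question_fun N0P ?leq_maxl// N1P ?leq_maxr.
  split; last by move=> s; apply; exists (maxn N0 N1).
  move=> _ [i _ <-].
  have le_mem (u : R) : (u \in (F i : set R)) ==> (u \in (A : set R)).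
    by apply/implyP; rewrite !inE; exact: FsubA.
  rewrite /question_fun; move: (le_mem 0) (le_mem 1).
  move: (0 \in (F i : set R)) (0 \in (A : set R)) => [] [] //= _;
    move: (1 \in (F i : set R)) (1 \in (A : set R)) => [] [] //= _;
    by rewrite ?ele0x ?elex1.
Qed.

Definition question (a : E) : observable :=
  Observable (question_is_observable a).

End observables.

Arguments question R {d E} a.

Section sum.
Context (R : realType) d (E : sigmaMVEffectAlgebraType d).
Implicit Types x y s : observable R E.

Definition is_obs_sum x y s : Prop :=
  bounded_observable s /\
  forall t : R,
    supremums
      (range (fun r : rat => (spectral_resolution x (ratr r) `&`
                              spectral_resolution y (t - ratr r))%O))
      (spectral_resolution s t).

(* "The" bounded observable with the prescribed spectral resolution; the
   default value x is irrelevant for bounded x and y, for which such an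
   observable exists and is unique.  Existence is not built in here: facts
   about [obs_sum x y] require it to be proved. *)
Definition obs_sum x y : observable R E := xget x (is_obs_sum x y).

End sum.

(* Main.v *)
Require Import Defs.
From HB Require Import structures.
From mathcomp Require Import all_boot all_order all_algebra.
From mathcomp Require Import all_classical all_reals all_analysis.
From mathcomp Require Import zify.

Set Implicit Arguments.
Unset Strict Implicit.
Unset Printing Implicit Defensive.

Import Order.TTheory GRing.Theory Num.Theory.
Import numFieldNormedType.Exports.
Local Open Scope classical_set_scope.
Local Open Scope ring_scope.

(** The algebra of the sum is soft. Write B x for the spectral resolution of x.
  Since resolutions are left continuous, B (x + y) t is the join of the meets B
  x r /\ B y (t - r) over all real r, so that commutativity is the substitution
  r |-> t - r. Binary meets distribute over existing joins in E
  ([meet_supremums]); hence both ways of adding three observables give the join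
  of B x p /\ B y q /\ B z r over p + q + r = t. An observable is determined by
  its resolution ([spectral_resolution_inj]), by Dynkin's theorem.

  The substance is that the sum exists, that is, that every left continuous
  increasing map f from the line to E which takes the values 0 and 1 is the
  resolution of an observable ([resolution_observable]). Observables need not
  be regular (in the algebra of Borel sets modulo meagre sets, the rationals
  have value 0, but every open set containing them is dense and has value 1),
  so outer measures do not give them. The remedy, in the spirit of the
  Loomis-Sikorski theorem, is to argue pointwise, with states w : E -> [0, 1]
  as points. Up to one-sided limits, w \o f is the distribution function of a
  probability mu_w on the line, and the value of the observable at A should be
  the element a with w(a) = mu_w(A) for almost every w. The sets A for which
  such an a exists form a Dynkin system that contains the rays, hence are all
  Borel sets.

  Here almost every w means every state that is continuous along the members of
  some fixed countable family of sequences decreasing to 0 in E ([generic]).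
  Countably many generic properties hold together, and continuity along one
  monotone sequence is generic by definition. What makes the notion useful is
  [generic_le]: if w(a) <= w(b) for generic w, then a <= b. This is an argument
  of Rasiowa-Sikorski type. If a is not below b, one goes down from a - b
  through nonzero elements that force w(a - b) > 0 first ([force_pos]) and
  then, one at a time, the countably many inequalities 2^k w(u_n) <= 1 that
  express continuity ([force_small]). A prime ideal P avoiding this descending
  sequence exists by Zorn's lemma ([prime_ideal_avoiding]), and any state
  vanishing on P has all the forced properties.

  A state vanishing on a prime ideal P comes from rotation numbers
  ([prime_ideal_state]). Modulo P the algebra E is totally ordered, and adding
  a to points of the circle obtained by gluing 1 to 0 is a rotation of this
  circle. The rotations by a and by b compose to the one by a + b, so the
  average number of turns made by iterating the rotation is additive in a. *)

(** * Partial sums in effect algebras *)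

Section effect_algebra.
Context d (E : effectAlgebraType d).
Implicit Types a b c s t u v w x y : E.
Local Open Scope order_scope.

Lemma eadd0x a : eadd ezero a = Some a.
Proof. by rewrite eaddC eaddx0. Qed.

Lemma eadd_assocl a b c u v : eadd b c = Some u -> eadd a u = Some v ->
  exists2 s, eadd a b = Some s & eadd s c = Some v.
Proof.
move=> bc au; have := eaddA a b c; rewrite bc /= au.
by case: (eadd a b) => //= s sc; exists s.
Qed.

Lemma eadd_assocr a b c s v : eadd a b = Some s -> eadd s c = Some v ->
  exists2 u, eadd b c = Some u & eadd a u = Some v.
Proof.
move=> ab sc; have := eaddA a b c; rewrite ab /= sc.
by case: (eadd b c) => //= u au; exists u.
Qed.

Lemma eorthoE a b : eadd a b = Some eone -> b = eortho a.
Proof. by move=> ab; apply: eadd_cancel1 ab _; exact: eadd_ortho. Qed.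

Lemma eorthoK a : eortho (eortho a) = a.
Proof. by apply/esym/eorthoE; rewrite eaddC eadd_ortho. Qed.

Lemma eadd_inj a b c s : eadd a b = Some s -> eadd a c = Some s -> b = c.
Proof.
rewrite ![eadd a _]eaddC => ba ca; have s1 := eadd_ortho s.
have [u au bu] := eadd_assocr ba s1.
have [u' au' cu] := eadd_assocr ca s1.
move: au'; rewrite au => -[uu']; rewrite -uu' in cu.
by apply: (@eadd_cancel1 _ _ u); rewrite eaddC.
Qed.

Lemma eadd_le a b s : eadd a b = Some s -> a <= s.
Proof. by move=> ab; apply/le_eadd; exists b. Qed.

Lemma eadd_ler a b s : eadd a b = Some s -> b <= s.
Proof. by rewrite eaddC; exact: eadd_le. Qed.

Lemma le0_eq a : a <= ezero -> a = ezero.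
Proof. by move=> a0; apply/eqP; rewrite eq_le a0 ele0x. Qed.

Lemma eadd_le_cancel a b c s t :
  eadd a b = Some s -> eadd a c = Some t -> s <= t -> b <= c.
Proof.
move=> ab ac /le_eadd[u su]; have [v bv av] := eadd_assocr ab su.
by rewrite (eadd_inj ac av); exact: eadd_le bv.
Qed.

Lemma eadd_le_mono a b c t : b <= c -> eadd a c = Some t ->
  exists2 s, eadd a b = Some s & s <= t.
Proof.
move=> /le_eadd[u bu] ac; have [s ab su] := eadd_assocl bu ac.
by exists s => //; exact: eadd_le su.
Qed.

Lemma eadd_le_anti a b c e s : eadd a b = Some s -> eadd c e = Some s ->
  a <= c -> e <= b.
Proof.
move=> ab ce /le_eadd[u au]; have [v ue av] := eadd_assocr au ce.
by rewrite (eadd_inj ab av); exact: eadd_ler ue.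
Qed.

Lemma eadd_def a b : (exists s, eadd a b = Some s) <-> b <= eortho a.
Proof.
split=> [[s ab]|/eadd_le_mono-/(_ _ _ (eadd_ortho a))[s ab _]]; last first.
  by exists s.
have [u bs au] := eadd_assocr ab (eadd_ortho s).
by rewrite -(eorthoE au); exact: eadd_le bs.
Qed.

Lemma eadd_eq0 a b : eadd a b = Some a -> b = ezero.
Proof. by move/eadd_inj; apply; exact: eaddx0. Qed.

Lemma eortho_zero : eortho (ezero : E) = eone.
Proof. by rewrite -eortho_one eorthoK. Qed.

Lemma le_eortho a b : a <= b -> eortho b <= eortho a.
Proof. by apply: eadd_le_anti; exact: eadd_ortho. Qed.

End effect_algebra.

(** * Truncated differences in MV-effect algebras *)

(** The difference of a and a /\ b: the truncated subtraction of MV-algebras,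
  which vanishes exactly when a <= b. *)
Definition ediff d (E : mvEffectAlgebraType d) (a b : E) : E :=
  xget ezero [set c | eadd (a `&` b)%O c = Some a].

Local Notation "a :-: b" := (ediff a b) (at level 50, left associativity).

Section mv_effect_algebra.
Context d (E : mvEffectAlgebraType d).
Implicit Types a b c e k p s t u v w x y : E.
Local Open Scope order_scope.

Lemma ediffP a b : eadd (a `&` b) (a :-: b) = Some a.
Proof.
rewrite /ediff; case: xgetP => [c _ //|noc].
have /le_eadd[c ac] : a `&` b <= a by exact: leIl.
by have := noc c; case.
Qed.

Lemma ediffK a b : b <= a -> eadd b (a :-: b) = Some a.
Proof. by move=> ba; rewrite -[X in eadd X](meet_r ba) ediffP. Qed.

Lemma ediffE a b c : eadd b c = Some a -> a :-: b = c.
Proof. by move=> bc; apply: eadd_inj (bc); apply/ediffK/(eadd_le bc). Qed.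

Lemma ediff_le a b : a :-: b <= a.
Proof. exact: eadd_ler (ediffP a b). Qed.

Lemma ediff0 a : a :-: ezero = a.
Proof. by apply: ediffE; exact: eadd0x. Qed.

Lemma ediff_eq0 a b : a <= b -> a :-: b = ezero.
Proof.
move=> ab; apply: (@eadd_inj _ _ a _ _ a); last exact: eaddx0.
by rewrite -{1}(meet_l ab) ediffP.
Qed.

Lemma ediff_le0 a b : a :-: b = ezero -> a <= b.
Proof.
by move=> ab0; have := ediffP a b; rewrite ab0 eaddx0 => -[<-]; exact: leIr.
Qed.

(** A common lower bound k of both differences satisfies (a /\ b) + k <= a /\
  b. *)
Lemma ediff_disjoint a b : (a :-: b) `&` (b :-: a) = ezero.
Proof.
set k := _ `&` _.
have [s aks sa] : exists2 s, eadd (a `&` b) k = Some s & s <= a.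
  by apply: eadd_le_mono (ediffP a b); exact: leIl.
have [s' + sb] : exists2 s, eadd (a `&` b) k = Some s & s <= b.
  by rewrite meetC; apply: eadd_le_mono (ediffP b a); exact: leIr.
rewrite aks => -[ss']; rewrite -ss' in sb.
apply: (@eadd_eq0 _ _ (a `&` b)).
suff -> : a `&` b = s by rewrite -aks; congr eadd; apply/eqP;
  rewrite eq_le (eadd_le aks) lexI sa sb.
by apply/eqP; rewrite eq_le (eadd_le aks) lexI sa sb.
Qed.

(** The defect k in s = (a \/ b) + k lies below both a and b, because the
  larger a \/ b is, the less has to be added to it to get s. *)
Lemma eadd_join a b s : a `&` b = ezero -> eadd a b = Some s -> s = a `|` b.
Proof.
move=> ab0 ab; have /le_eadd[k jk] : a `|` b <= s.
  by rewrite leUx (eadd_le ab) (eadd_ler ab).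
have kb : k <= b by apply: eadd_le_anti ab jk _; exact: leUl.
have ka : k <= a.
  by rewrite eaddC in ab; apply: eadd_le_anti ab jk _; exact: leUr.
have k0 : k = ezero by apply: le0_eq; rewrite -ab0 lexI ka kb.
by move: jk; rewrite k0 eaddx0 => -[].
Qed.

(** All pairs in an MV-effect algebra are compatible: the parts of a and of b
  beyond a /\ b are disjoint, hence summable, and adding their sum to a /\ b
  gives the join. *)
Lemma eadd_ediff a b : eadd b (a :-: b) = Some (a `|` b).
Proof.
have xy0 := ediff_disjoint a b; set x := a :-: b in xy0 *.
set y := b :-: a in xy0; have mx : eadd (a `&` b) x = Some a := ediffP a b.
have my : eadd (a `&` b) y = Some b by rewrite meetC; exact: ediffP.
have := eadd_disjoint _ _ xy0; case xy: (eadd x y) => [z|//] _.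
have zE := eadd_join xy0 xy.
have [t mz] : exists t, eadd (a `&` b) z = Some t.
  by apply/eadd_def; rewrite zE leUx; apply/andP; split; apply/eadd_def;
    [exists a|exists b].
have bx : eadd b x = Some t.
  rewrite eaddC in xy; have [s] := eadd_assocl xy mz.
  by rewrite my => -[<-].
rewrite bx; congr Some; apply/eqP; rewrite eq_le; apply/andP; split; last first.
  rewrite leUx (eadd_le bx) andbT.
  by have [s] := eadd_assocl xy mz; rewrite mx => -[<-] /eadd_le.
have /le_eadd[w mw] : a `&` b <= a `|` b.
  by rewrite (le_trans (leIl _ _))// leUl.
suff zw : z <= w.
  by have [t'] := eadd_le_mono zw mw; rewrite mz => -[<-].
rewrite zE leUx; apply/andP; split.
  by apply: eadd_le_cancel mx (mw) _; exact: leUl.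
by apply: eadd_le_cancel my mw _; exact: leUr.
Qed.

Lemma ediff_le_eadd a b p s : eadd b p = Some s -> a <= s -> a :-: b <= p.
Proof.
move=> bp as_; apply: eadd_le_cancel (eadd_ediff a b) (bp) _.
by rewrite leUx as_ (eadd_le bp).
Qed.

Lemma ediff_mono a b c : a <= b -> a :-: c <= b :-: c.
Proof.
move=> ab; apply: ediff_le_eadd (eadd_ediff b c) _.
by rewrite (le_trans ab)// leUl.
Qed.

(** The elements disjoint from c form an ideal: what lies below both a + b and
  c is disjoint from a, hence already below b. *)
Lemma disjoint_eadd a b c s : a `&` c = ezero -> b `&` c = ezero ->
  eadd a b = Some s -> s `&` c = ezero.
Proof.
move=> ac0 bc0 ab; apply: le0_eq; rewrite -bc0 lexI leIr andbT.
have kb : (s `&` c) :-: a <= b by exact: ediff_le_eadd ab (leIl s c).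
have ka : (s `&` c) `&` a = ezero.
  by apply: le0_eq; rewrite -ac0 lexI leIr/= (le_trans (leIl _ _)) ?leIr.
by have := ediffP (s `&` c) a; rewrite ka eadd0x => -[<-].
Qed.

Lemma ediff_anti a b c : a `&` b <= a `&` c -> a :-: c <= a :-: b.
Proof. exact: (eadd_le_anti (ediffP a b) (ediffP a c)). Qed.

(** Distributivity for arbitrary existing joins. If u bounds all a /\ x, then
  (a /\ b) - u is below b - x for every x in A; so b minus this difference is
  an upper bound of A, and the difference is 0. *)
Lemma meet_supremums a b (A : set E) : supremums A b ->
  supremums [set a `&` x | x in A] (a `&` b).
Proof.
move=> [ubA lubA]; split=> [_ [x Ax <-]|u ubu].
  by rewrite lexI leIl (le_trans (leIr _ _))// ubA.
set ab := a `&` b; set v := ab :-: u.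
suff v0 : v = ezero by exact: ediff_le0.
have bv : eadd (b :-: v) v = Some b.
  by rewrite eaddC ediffK// (le_trans (ediff_le _ _))// leIr.
(* b - v = b means v = 0. *)
suff bbv : b <= b :-: v.
  by apply/le0_eq/(eadd_le_anti _ bv bbv); exact: eaddx0.
apply: lubA => x Ax; rewrite eaddC in bv.
have xb := ubA _ Ax; have bx := ediffK xb; rewrite eaddC in bx.
apply: (eadd_le_anti bv bx); apply: le_trans (ediff_mono x (leIr b a)).
apply: ediff_anti; rewrite lexI leIl/=.
by apply: ubu; exists x => //; rewrite /ab -meetA (meet_r xb).
Qed.

End mv_effect_algebra.

(** * The totally ordered quotient by a prime ideal *)

Record prime_ideal d (E : mvEffectAlgebraType d) (P : set E) : Prop :=
  PrimeIdeal {
  prime_le : forall a b, (a <= b)%O -> P b -> P a;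
  prime_eadd : forall a b s, eadd a b = Some s -> P a -> P b -> P s;
  prime_disjoint : forall a b, (a `&` b)%O = ezero -> P a \/ P b;
  prime_one : ~ P eone
}.

Section order_modulo_prime.
Context d (E : mvEffectAlgebraType d) (P : set E) (primeP : prime_ideal P).
Implicit Types a b c p q u v w x y r : E.
Local Open Scope order_scope.

(** The order of the quotient of E by P, carried by the elements of E
  themselves. *)
Definition lemod a b := P (a :-: b).
Local Notation "a <~ b" := (lemod a b) (at level 70, no associativity).
Definition eqmod a b := lemod a b /\ lemod b a.
Local Notation "a =~ b" := (eqmod a b) (at level 70, no associativity).

Lemma prime_zero : P ezero.
Proof. by have [] := prime_disjoint primeP (meetxx (ezero : E)). Qed.

Lemma lemod_le a b : a <= b -> a <~ b.
Proof. by move=> ab; rewrite /lemod ediff_eq0//; exact: prime_zero. Qed.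

Lemma lemod_refl a : a <~ a. Proof. exact: lemod_le. Qed.

Lemma lemod_total a b : a <~ b \/ b <~ a.
Proof. by apply: (prime_disjoint primeP); exact: ediff_disjoint. Qed.

Lemma lemod_eaddr a b p s : eadd b p = Some s -> a <= s -> P p -> a <~ b.
Proof. by move=> bp /(ediff_le_eadd bp) /(prime_le primeP). Qed.

Lemma lemod_eaddl a b c p : eadd c p = Some a -> c <= b -> P p -> a <~ b.
Proof.
move=> cp cb; apply: (prime_le primeP); apply: eadd_le_anti (cp) (ediffP a b) _.
by rewrite lexI cb (eadd_le cp).
Qed.

Lemma lemod_trans a b c : a <~ b -> b <~ c -> a <~ c.
Proof.
move=> ab bc; set m := a `&` b.
have mc : P (m :-: c).
  by apply: (prime_le primeP) bc; apply: ediff_mono; exact: leIr.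
have [q qE qa] := eadd_assocr (ediffP m c) (ediffP a b).
by apply: lemod_eaddl qa (leIr _ _) _; exact: (prime_eadd primeP) qE mc ab.
Qed.

Lemma lemod_meet a b : a <~ b -> a <~ a `&` b.
Proof. by move=> ab; apply: lemod_eaddl (ediffP a b) _ ab. Qed.

Lemma lemod_eadd x y u v s t : eadd x u = Some s -> eadd y v = Some t ->
  x <~ y -> u <~ v -> s <~ t.
Proof.
move=> xu yv xy uv; have [w xu1 ws] := eadd_assocl (ediffP u v) xu.
apply: (@lemod_trans _ w); first exact: lemod_eaddl ws _ uv.
rewrite eaddC in xu1; have [w' x1u1 w'w] := eadd_assocl (ediffP x y) xu1.
apply: lemod_eaddl w'w _ xy.
have [z yu1 zt] := eadd_le_mono (leIr v u) yv.
rewrite eaddC in yu1; have [z'] := eadd_le_mono (leIr y x) yu1.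
by rewrite x1u1 => -[<-] /le_trans; exact.
Qed.

Lemma lemod_eortho a b : a <~ b -> eortho b <~ eortho a.
Proof.
move=> ab; have [u pa /eorthoE uE] := eadd_assocr (ediffP a b) (eadd_ortho a).
rewrite eaddC in pa; apply: lemod_eaddr pa _ ab.
by rewrite uE; apply: le_eortho; exact: leIr.
Qed.

Lemma lemod_cancel x y u v s t : eadd x u = Some s -> eadd y v = Some t ->
  s <~ t -> v <~ u -> x <~ y.
Proof.
move=> xu yv st vu; rewrite -(eorthoK x) -(eorthoK y); apply: lemod_eortho.
have [x' ux' /eorthoE x'E] := eadd_assocr xu (eadd_ortho s).
have [y' vy' /eorthoE y'E] := eadd_assocr yv (eadd_ortho t).
rewrite -x'E -y'E; apply: lemod_eadd vy' ux' vu _; exact: lemod_eortho.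
Qed.

Lemma eqmod_refl a : a =~ a. Proof. by split; exact: lemod_refl. Qed.

Lemma eqmod_sym a b : a =~ b -> b =~ a. Proof. by case. Qed.

Lemma eqmod_trans a b c : a =~ b -> b =~ c -> a =~ c.
Proof.
move=> [ab ba] [bc cb].
by split; [exact: lemod_trans bc|exact: lemod_trans ba].
Qed.

Lemma eqmod_eadd x y u v s t : eadd x u = Some s -> eadd y v = Some t ->
  x =~ y -> u =~ v -> s =~ t.
Proof.
move=> xu yv [xy yx] [uv vu].
by split; [exact: lemod_eadd xu yv _ _|exact: lemod_eadd yv xu _ _].
Qed.

Lemma eqmod_cancel x y u v s t : eadd x u = Some s -> eadd y v = Some t ->
  s =~ t -> u =~ v -> x =~ y.
Proof.
move=> xu yv [st ts] [uv vu].
by split; [exact: lemod_cancel xu yv _ _|exact: lemod_cancel yv xu _ _].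
Qed.

Lemma eqmod_meet a b : a <~ b -> a `&` b =~ a.
Proof.
by move=> ab; split; [apply: lemod_le; exact: leIl|exact: lemod_meet].
Qed.

(** Decompositions of an element modulo P lift to honest decompositions: cut v
  at v /\ x, which is x modulo P. *)
Lemma eqmod_split x y v s : eadd x y = Some s -> v =~ s ->
  exists x1 y1, [/\ eadd x1 y1 = Some v, x1 =~ x & y1 =~ y].
Proof.
move=> xy vs; have xv : x <~ v.
  by apply: lemod_trans vs.2; exact/lemod_le/(eadd_le xy).
exists (v `&` x), (v :-: x); rewrite ediffP; split => //.
  by rewrite meetC; exact: eqmod_meet.
rewrite eaddC in xy; have vx := ediffP v x; rewrite eaddC in vx.
by apply: eqmod_cancel vx xy vs _; rewrite meetC; exact: eqmod_meet.
Qed.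

(** * Rotation numbers *)

(** The pair (m, r) stands for m + r in the group generated by the quotient
  chain, and [rot a] adds a to it. The new remainder is r + a, written as the
  complement of a' - r, if this does not exceed 1, and r + a - 1 = r - a'
  otherwise. *)
Definition rot a (s : nat * E) : nat * E :=
  if `[< s.2 <~ eortho a >] then (s.1, eortho (eortho a :-: s.2))
  else (s.1.+1, s.2 :-: eortho a).

(** In both cases the new remainder is tied to r by a sum that is defined in E,
  up to replacing one summand modulo P; this is the form that cancellation laws
  apply to. *)
Lemma rotP a m r :
  (r <~ eortho a /\ exists r1 r2, [/\ rot a (m, r) = (m, r2), r1 =~ r
     & eadd r1 a = Some r2]) \/
  (~ r <~ eortho a /\ exists u r2, [/\ rot a (m, r) = (m.+1, r2), u =~ eortho a
     & eadd r2 u = Some r]).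
Proof.
rewrite /rot /=; have [ra|ra] := pselect (r <~ eortho a).
  left; split => //; rewrite asboolT//.
  exists (eortho a `&` r), (eortho (eortho a :-: r)); split => //.
    by rewrite meetC; exact: eqmod_meet.
  have [s as_ /eorthoE ->] := eadd_assocl (ediffP (eortho a) r) (eadd_ortho a).
  by rewrite eorthoK eaddC.
right; split => //; rewrite asboolF//.
exists (r `&` eortho a), (r :-: eortho a); split => //.
  have [//|ar] := lemod_total r (eortho a).
  by rewrite meetC; exact: eqmod_meet.
by rewrite eaddC ediffP.
Qed.

Definition lexle (s t : nat * E) : Prop :=
  (s.1 < t.1)%N \/ (s.1 = t.1 /\ s.2 <~ t.2).

Definition lexeq (s t : nat * E) := lexle s t /\ lexle t s.

Lemma lexle_fst (s t : nat * E) : lexle s t -> (s.1 <= t.1)%N.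
Proof. by move=> [/ltnW//|[->]]. Qed.

Lemma lexle_refl (s : nat * E) : lexle s s.
Proof. by right; split => //; exact: lemod_refl. Qed.

Lemma lexle_trans (s t u : nat * E) : lexle s t -> lexle t u -> lexle s u.
Proof.
move=> [st|[st st2]] [tu|[tu tu2]].
- by left; exact: ltn_trans tu.
- by left; rewrite -tu.
- by left; rewrite st.
- by right; split; [rewrite st|exact: lemod_trans tu2].
Qed.

Lemma rot_mono a (s t : nat * E) : lexle s t -> lexle (rot a s) (rot a t).
Proof.
case: s t => [m r] [n r'] /= st.
have [[ra [r1 [r2 [-> r1r r1a]]]]|[ra [u [r2 [-> ua r2u]]]]] := rotP a m r;
have [[ra' [r1' [r2' [-> r1r' r1a']]]]|[ra' [u' [r2' [-> ua' r2u']]]]] :=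
  rotP a n r';
case: st => /= [mn|[-> rr']].
- by left.
- right; split => //=; apply: lemod_eadd r1a r1a' _ (lemod_refl _).
  by apply: lemod_trans r1r'.2; apply: lemod_trans r1r.1 _.
- by left; exact: ltnW.
- by left => /=.
- rewrite /lexle/=; case: (ltnP m.+1 n) => mn1; [by left|right; split].
    by apply/eqP; rewrite eqn_leq mn mn1.
  apply: (@lemod_trans _ a).
    rewrite eaddC in r2u; have r2u' := r2u; rewrite eaddC in r2u'.
    apply: lemod_cancel (r2u') (eadd_ortho a) _ ua.2.
    by apply: lemod_le; exact: elex1.
  by apply: lemod_le; exact: eadd_ler r1a'.
- by case: ra; exact: lemod_trans ra'.
- by left.
- right; split => //=; apply: lemod_cancel r2u r2u' rr' _.
  by apply: lemod_trans ua'.1 ua.2.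
Qed.

(** Where a + b = c, the relations b + c' = a' and a + c' = b' decide which of
  the steps carry: if c does not carry then neither do b and a, and if c
  carries then exactly one of them does. *)
Lemma rot_eadd a b c (s : nat * E) : eadd a b = Some c ->
  lexeq (rot c s) (rot a (rot b s)).
Proof.
case: s => m r ab; suff [n [x [y [-> -> xy]]]] : exists n x y,
    [/\ rot c (m, r) = (n, x), rot a (rot b (m, r)) = (n, y) & x =~ y].
  by split; right; split => //=; case: xy.
have [a' bc /eorthoE aE] := eadd_assocr ab (eadd_ortho c).
have [b' ac /eorthoE bE] := eadd_assocr (etrans (eaddC b a) ab) (eadd_ortho c).
rewrite {}aE {a'} in bc; rewrite {}bE {b'} in ac.
have [[rc [r1 [r2 [-> r1r r1c]]]]|[rc [u [r2 [-> uc r2u]]]]] := rotP c m r;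
have [[rb [rb1 [rb2 [-> rb1r rb1b]]]]|[rb [v [rb2 [-> vb rb2v]]]]] :=
  rotP b m r.
(* No carry for c: none for b and none for a. *)
- have rba : rb2 <~ eortho a.
    rewrite eaddC in bc; apply: lemod_eadd rb1b bc _ (lemod_refl _).
    exact: lemod_trans rb1r.1 rc.
  have [[_ [q [r3 [-> qrb qa]]]]|[//]] := rotP a m rb2.
  exists m, r2, r3; split => //.
  rewrite eaddC in ab; have [w r1b wa] := eadd_assocl ab r1c.
  apply: eqmod_eadd wa qa _ (eqmod_refl _).
  apply: (@eqmod_trans _ rb2); last exact: eqmod_sym.
  apply: eqmod_eadd r1b rb1b _ (eqmod_refl _).
  by apply: eqmod_trans r1r _; exact: eqmod_sym.
(* No carry for c but a carry for b is impossible, as c' <= b'. *)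
- by case: rb; apply: lemod_trans rc _; exact/lemod_le/(eadd_ler ac).
(* A carry for c but none for b: then a carries. *)
- have nrba : ~ rb2 <~ eortho a.
    move=> rba; apply: rc; apply: lemod_trans rb1r.2 _.
    by rewrite eaddC in bc; apply: lemod_cancel rb1b bc rba (lemod_refl _).
  have [[//]|[_ [w [r3 [-> wa r3w]]]]] := rotP a m rb2.
  exists m.+1, r2, r3; split => //.
  rewrite eaddC in bc.
  have [c2 [b2 [cb2 c2c b2b]]] := eqmod_split bc wa.
  have [z r3c zb] := eadd_assocl cb2 r3w.
  have zr : z =~ r.
    by apply: eqmod_trans rb1r; apply: eqmod_cancel zb rb1b (eqmod_refl _) b2b.
  apply: eqmod_cancel r2u r3c (eqmod_sym zr) _.
  by apply: eqmod_trans uc _; exact: eqmod_sym.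
(* A carry for b, hence for c: the remainder is below b, so a does not carry. *)
- have rba : rb2 <~ eortho a.
    apply: (@lemod_trans _ b); last by apply/lemod_le/eadd_def; exists c.
    apply: lemod_cancel rb2v (eadd_ortho b) _ vb.2.
    by apply: lemod_le; exact: elex1.
  have [[_ [q [r3 [-> qrb qa]]]]|[//]] := rotP a m.+1 rb2.
  exists m.+1, r2, r3; split => //.
  have [a2 [c2 [ac2 a2a c2c]]] := eqmod_split ac vb.
  have [z rb2a zc] := eadd_assocl ac2 rb2v.
  apply: (@eqmod_trans _ z).
    apply: eqmod_cancel r2u zc (eqmod_refl _) _.
    by apply: eqmod_trans uc _; exact: eqmod_sym.
  by apply: eqmod_eadd rb2a qa _ a2a; exact: eqmod_sym.
Qed.

Lemma lexeq_trans (s t u : nat * E) : lexeq s t -> lexeq t u -> lexeq s u.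
Proof.
by move=> [st ts] [tu ut]; split; [exact: lexle_trans tu|exact: lexle_trans ts].
Qed.

Lemma lexeq_sym (s t : nat * E) : lexeq s t -> lexeq t s. Proof. by case. Qed.

Lemma lexeq_refl (s : nat * E) : lexeq s s.
Proof. by split; exact: lexle_refl. Qed.

Lemma rot_lexeq a (s t : nat * E) : lexeq s t -> lexeq (rot a s) (rot a t).
Proof. by move=> [st ts]; split; exact: rot_mono. Qed.

Lemma iter_rot_mono a n (s t : nat * E) : lexle s t ->
  lexle (iter n (rot a) s) (iter n (rot a) t).
Proof. by move=> st; elim: n => //= n; exact: rot_mono. Qed.

(** The rotations by a and by b commute, both composites being the rotation by
  c. *)
Lemma iter_rot_eadd a b c n (s : nat * E) : eadd a b = Some c ->
  lexeq (iter n (rot c) s) (iter n (rot a) (iter n (rot b) s)).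
Proof.
move=> ab; have ba : eadd b a = Some c by rewrite eaddC.
have comm k t : lexeq (rot b (iter k (rot a) t)) (iter k (rot a) (rot b t)).
  elim: k => [|k IH]; first exact: lexeq_refl.
  apply: lexeq_trans (rot_lexeq a IH) => /=.
  by apply: lexeq_trans (lexeq_sym (rot_eadd _ ba)) (rot_eadd _ ab).
elim: n => [|n IH]; first exact: lexeq_refl.
apply: lexeq_trans (rot_lexeq c IH) _.
by apply: lexeq_trans (rot_eadd _ ab) _; apply: rot_lexeq; exact: comm.
Qed.

Lemma rot_shift a k m r : rot a (k + m, r)%N =
  ((k + (rot a (m, r)).1)%N, (rot a (m, r)).2).
Proof. by rewrite /rot/=; case: asboolP => //= _; rewrite addnS. Qed.

Lemma iter_rot_shift a n k m r : iter n (rot a) (k + m, r)%N =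
  ((k + (iter n (rot a) (m, r)).1)%N, (iter n (rot a) (m, r)).2).
Proof.
elim: n => //= n ->; rewrite rot_shift.
by case: (iter n _ _).
Qed.

(** The limit of winding n a / n is the rotation number of a. *)
Definition winding n a : nat := (iter n (rot a) (0, eone)%N).1.

(** The n turns by a start at the remainder left by the n turns by b instead of
  at 1; by monotonicity this changes the number of full turns by at most 1. *)
Lemma winding_eadd n a b c : eadd a b = Some c ->
  (winding n c <= winding n a + winding n b <= (winding n c).+1)%N.
Proof.
move=> ab; have [] := iter_rot_eadd n (0, eone)%N ab.
move=> /lexle_fst + /lexle_fst; rewrite -/(winding n c).
case bE : (iter n (rot b) _) => [k r].
have kE : k = winding n b by rewrite /winding bE.
rewrite -(addn0 k) iter_rot_shift/= kE.
have r1 : lexle (0, r)%N (0, eone)%N.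
  by right; split => //; exact/lemod_le/elex1.
have r2 : lexle (0, eone)%N (1 + 0, r)%N by left.
have /lexle_fst := iter_rot_mono a n r1; rewrite -/(winding n a).
have /lexle_fst := iter_rot_mono a n r2.
rewrite iter_rot_shift/= -/(winding n a).
lia.
Qed.

Lemma winding_one n : winding n eone = n.
Proof.
rewrite /winding; suff -> : iter n (rot eone) (0, eone)%N = (n, eone) by [].
elim: n => //= n ->; rewrite /rot/= eortho_one ediff0 asboolF//.
by rewrite /lemod ediff0; exact: prime_one.
Qed.

Lemma winding_ideal n p : P p -> winding n p = 0%N.
Proof.
move=> Pp; rewrite /winding; elim: n => //= n.
case: (iter n _ _) => _ r /= ->; rewrite /rot/= asboolT//.
apply: (@lemod_trans _ eone); first exact/lemod_le/elex1.
have := eadd_ortho p; rewrite eaddC => p1.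
by apply: lemod_eaddr p1 _ Pp; exact: elex1.
Qed.

(** Hence winding n a / n decreases along the powers of 2, which yields the
  limit without further estimates. *)
Lemma winding_double n a : (winding (n + n) a <= winding n a + winding n a)%N.
Proof.
rewrite {1}/winding iterD; case tE : (iter n (rot a) (0, eone)%N) => [k r].
have -> : k = winding n a by rewrite /winding tE.
rewrite -{1}(addn0 (winding n a)) iter_rot_shift/= leq_add2l.
by apply/lexle_fst/iter_rot_mono; right; split => //; exact/lemod_le/elex1.
Qed.

End order_modulo_prime.

(** * States *)

Record is_state (R : realType) d (E : effectAlgebraType d) (w : E -> R) :
    Prop := IsState {
  state_ge0 : forall a, 0 <= w a;
  state_one : w eone = 1;
  state_eadd : forall a b c, eadd a b = Some c -> w c = w a + w b
}.

(** The state is the rotation number; the bounded defect of additivity of the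
  winding number disappears in the limit. *)
Lemma prime_ideal_state (R : realType) d (E : mvEffectAlgebraType d)
    (P : set E) : prime_ideal P ->
  exists w : E -> R, is_state w /\ forall p, P p -> w p = 0.
Proof.
move=> primeP; pose u a k : R := (winding P (2 ^ k) a)%:R / (2 ^ k)%:R.
have pow_gt0 k : 0 < (2 ^ k)%:R :> R by rewrite ltr0n expn_gt0.
have u_ge0 a k : 0 <= u a k by rewrite divr_ge0.
have u_cvg a : cvgn (u a).
  apply: nonincreasing_is_cvgn; last by exists 0 => _ [k _ <-].
  apply/nonincreasing_seqP => k; rewrite /u ler_pdivrMr// mulrAC.
  rewrite ler_pdivlMr// -!natrM ler_nat expnS mul2n -addnn.
  set m := winding P (2 ^ k) a.
  rewrite [leqRHS](_ : _ = (m + m) * 2 ^ k)%N; last by rewrite mulnDr mulnDl.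
  by rewrite leq_mul2r winding_double// orbT.
exists (fun a => limn (u a)); split; first split.
- by move=> a; apply: limr_ge => //; exact: nearW.
- rewrite (_ : u eone = cst 1); first exact: lim_cst.
  by apply/funext => k; rewrite /u winding_one//= divff// gt_eqF.
- move=> a b c ab; apply/eqP; rewrite -subr_eq0; apply/eqP.
  have uabc : (fun k => u c k - (u a k + u b k)) @ \oo -->
      limn (u c) - (limn (u a) + limn (u b)).
    by apply: cvgB => //; apply: cvgD.
  apply: (cvg_unique _ uabc) => //.
  apply: norm_cvg0.
  apply: (@squeeze_cvgr _ _ _ _ (cst 0) (fun k => 2^-1 ^+ k)).
  + near=> k; rewrite normr_ge0 /u -mulrDl -mulrBl normrM normfV.
    rewrite (ger0_norm (ltW (pow_gt0 k))) exprVn -natrX ler_pdivrMr//.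
    rewrite mulVf ?gt_eqF//.
    have /andP[ca ac] := winding_eadd primeP (2 ^ k) ab.
    have {ca}: (winding P (2 ^ k) c)%:R <=
        (winding P (2 ^ k) a)%:R + (winding P (2 ^ k) b)%:R :> R.
      by rewrite -natrD ler_nat.
    have {ac}: (winding P (2 ^ k) a)%:R + (winding P (2 ^ k) b)%:R <=
        (winding P (2 ^ k) c)%:R + 1 :> R by rewrite -natrD natr1 ler_nat.
    move: (winding P _ c)%:R (_ + _) => x y yx xy.
    by rewrite ler_distl lerBlDr yx (le_trans xy)// lerDl.
  + exact: cvg_cst.
  + by apply: cvg_expr; rewrite ger0_norm ?invr_ge0// invf_lt1// ltr1n.
- move=> p Pp; rewrite (_ : u p = cst 0) ?lim_cst//.
  by apply/funext => k; rewrite /u winding_ideal// mul0r.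
Unshelve. all: by end_near. Qed.

Section state_theory.
Context (R : realType) d (E : mvEffectAlgebraType d).
Context (w : E -> R) (ws : is_state w).
Implicit Types a b : E.

Lemma state_zero : w ezero = 0.
Proof.
have := state_eadd ws (eaddx0 (ezero : E)) => /eqP.
by rewrite -subr_eq0 opprD addNKr oppr_eq0 => /eqP.
Qed.

Lemma state_le a b : (a <= b)%O -> w a <= w b.
Proof.
by move=> /le_eadd[c /(state_eadd ws) ->]; rewrite lerDl (state_ge0 ws).
Qed.

Lemma state_le1 a : w a <= 1.
Proof. by rewrite -(state_one ws); exact/state_le/elex1. Qed.

Lemma state_ediff a b : w a = w (a `&` b)%O + w (a :-: b).
Proof. exact/(state_eadd ws)/ediffP. Qed.

Lemma state_eortho a : w (eortho a) = 1 - w a.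
Proof.
by rewrite -(state_one ws) (state_eadd ws (eadd_ortho a)) addrAC subrr add0r.
Qed.

Lemma state_lemod (P : set E) a b : (forall p, P p -> w p = 0) ->
  lemod P a b -> w a <= w b.
Proof.
by move=> wP /wP ab; rewrite (state_ediff a b) ab addr0 state_le// leIr.
Qed.

End state_theory.

(** * Generic states *)

(** Take U maximal among the sets closed under meets whose members meet every e
  n. The ideal consists of the elements disjoint from u /\ e n for some u in U
  and some n, and primality is the maximality of U. *)
Lemma prime_ideal_avoiding d (E : mvEffectAlgebraType d) (e : nat -> E) :
  (forall n, (e n.+1 <= e n)%O) -> (forall n, e n <> ezero) ->
  exists P : set E, prime_ideal P /\ forall n, ~ P (e n).
Proof.
move=> e_decr e_neq0.
have e_anti m n : (m <= n)%N -> (e n <= e m)%O.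
  move=> mn; rewrite -(subnK mn); elim: (n - m)%N => //= k.
  by apply: le_trans; exact: e_decr.
pose filterish (U : set E) := (forall x y, U x -> U y -> U (x `&` y)%O) /\
  forall x n, U x -> (x `&` e n)%O <> ezero.
have [F Fsub Ftot|U [[UI Un0] Umax]] := @Zorn_bigcup E filterish.
  split=> [x y [X FX Xx] [Y FY Yy]|x n [X /Fsub[_ +] Xx]]; last exact.
  have [XY|YX] := Ftot _ _ FX FY.
    by exists Y => //; apply: (Fsub _ FY).1 => //; exact: XY.
  by exists X => //; apply: (Fsub _ FX).1 => //; exact: YX.
(* U may be empty, so the top element is adjoined to it. *)
pose V x := U x \/ x = eone.
have meet1x (x : E) : (eone `&` x)%O = x by rewrite (meet_r (elex1 x)).
have meetx1 (x : E) : (x `&` eone)%O = x by rewrite (meet_l (elex1 x)).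
have VI x y : V x -> V y -> V (x `&` y)%O.
  move=> [Ux|->] [Uy|->]; rewrite ?meet1x ?meetx1;
    [left; exact: UI|by left..|by right].
have Vn0 x n : V x -> (x `&` e n)%O <> ezero.
  by move=> [/Un0//|->]; rewrite meet1x.
pose P x := exists u n, V u /\ (x `&` (u `&` e n))%O = ezero.
have notP a : ~ P a -> U a.
  (* If a meets everything in V at each e n, it can be adjoined to U. *)
  move=> nPa; pose B z := exists2 v, V v & z = v \/ z = (v `&` a)%O.
  have QB : filterish B.
    split=> [_ _ [x Vx [->|->]] [y Vy [->|->]]|_ n [x Vx [->|->]]].
    - by exists (x `&` y)%O; [exact: VI|left].
    - by exists (x `&` y)%O; [exact: VI|right; rewrite meetA].
    - by exists (x `&` y)%O; [exact: VI|right; rewrite meetAC].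
    - by exists (x `&` y)%O; [exact: VI|right; rewrite meetACA meetxx].
    - exact: Vn0.
    - by move=> xan; apply: nPa; exists x, n; rewrite meetCA meetA.
  have BU : B `<=` U.
    apply: contrapT => nBU; apply: (Umax B) QB; split => // x Ux.
    by exists x; left.
  by apply: BU; exists eone; [right|right; rewrite meet1x].
exists P; split; first split.
- move=> a b ab [u [n [Vu b0]]]; exists u, n; split => //.
  by apply: le0_eq; rewrite -b0 leI2.
- move=> a b s ab [u [m [Vu am]]] [v [n [Vv bn]]].
  exists (u `&` v)%O, (maxn m n); split; first exact: VI.
  apply: disjoint_eadd ab; apply: le0_eq.
    by rewrite -am leI2// leI2 ?leIl// e_anti// leq_maxl.
  by rewrite -bn leI2// leI2 ?leIr// e_anti// leq_maxr.
- move=> a b ab0; have [|nPa] := pselect (P a); first by left.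
  right; exists a, 0%N; split; first by left; exact: notP.
  by rewrite meetA [(b `&` a)%O]meetC ab0 (meet_l (ele0x _)).
- by move=> [u [n [Vu]]]; rewrite meet1x; exact: Vn0.
- move=> n [u [m [Vu enm]]]; apply: (Vn0 u (maxn m n) Vu); apply: le0_eq.
  rewrite -enm lexI (le_trans (leIr _ _)) ?e_anti ?leq_maxr//=.
  by rewrite leI2// e_anti// leq_maxl.
Qed.

Section generic_states.
Context (R : realType) d (E : sigmaMVEffectAlgebraType d).
Implicit Types (a b c e f g : E) (u : nat -> E) (w : E -> R).

Definition vanishing_state (P : set E) w :=
  is_state w /\ forall p, P p -> w p = 0.

(** The forcing relation: a condition is a nonzero element, read as the claim
  that it lies outside of P. *)
Definition forced (e : E) (S : (E -> R) -> Prop) :=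
  forall P w, prime_ideal P -> ~ P e -> vanishing_state P w -> S w.

(** The algebra is Archimedean: if all multiples of c existed, their join s
  would satisfy s <= s - c. The multiple m is described by its values at
  states. *)
Lemma exists_eadd_undefined c : c <> ezero ->
  exists n m, (forall w, is_state w -> w m = n%:R * w c) /\ eadd c m = None.
Proof.
move=> c0; apply: contrapT => noundef.
pose mul n := iter n (fun m => odflt ezero (eadd c m)) ezero.
have mulS n : (forall w, is_state w -> w (mul n) = n%:R * w c) /\
    eadd c (mul n) = Some (mul n.+1).
  have step m : (forall w, is_state w -> w (mul m) = m%:R * w c) ->
      eadd c (mul m) = Some (mul m.+1).
    rewrite [mul m.+1]iterS -/(mul m); case cm : (eadd c (mul m)) => [x|] // wm.
    by exfalso; apply: noundef; exists m, (mul m).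
  suff wn : forall w, is_state w -> w (mul n) = n%:R * w c.
    by split => //; exact: step.
  elim: n => [w ws|n IH w ws]; first by rewrite mul0r; exact: state_zero ws.
  by rewrite (state_eadd ws (step n IH)) IH// mulrSr mulrDl mul1r addrC.
have [s [ubs lubs]] := @countable_join _ E (range mul) (card_image_le _ _).
have /le_eadd[t ct] : (c <= s)%O.
  by apply: ubs; exists 1%N => //=; rewrite eaddx0.
have st : (s <= t)%O.
  apply: lubs => _ [n _ <-]; apply: eadd_le_cancel (mulS n).2 ct _.
  by apply: ubs; exists n.+1.
have ts : t = s by apply/eqP; rewrite eq_le st (eadd_ler ct).
by apply: c0; apply: (@eadd_eq0 _ _ s); rewrite eaddC -{1}ts.
Qed.

(** Let m = n c be the last multiple of c that exists. The condition c - m'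
  makes c + m exceed 1, that is, (n + 1) w(c) >= 1. *)
Lemma force_pos c : c <> ezero ->
  exists e, [/\ e <> ezero, (e <= c)%O & forced e (fun w => 0 < w c)].
Proof.
move=> /exists_eadd_undefined[n [m [wm cm]]].
exists (c :-: eortho m); split.
- move=> /ediff_le0 /eadd_def[s]; rewrite eaddC cm //.
- exact: ediff_le.
- move=> P w primeP nPe [ws wP].
  have [//|mc] := prime_disjoint primeP (ediff_disjoint c (eortho m)).
  have := state_lemod ws wP mc; rewrite state_eortho// wm// lerBlDl.
  rewrite -[X in _ + X]mul1r -mulrDl => w1.
  have := state_ge0 ws c; rewrite le_eqVlt => /predU1P[wc|//].
  by move: w1; rewrite -wc mulr0 ler10.
Qed.

Definition null_seq u := (forall n, (u n.+1 <= u n)%O) /\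
  forall x, (forall n, (x <= u n)%O) -> x = ezero.

Lemma null_seq_ediff u e : null_seq u -> e <> ezero ->
  exists n, e :-: u n <> ezero.
Proof.
move=> [_ u0] e0; apply: contrapT => /forallNP eu; apply/e0/u0 => n.
by apply: ediff_le0; apply: contrapT; exact: eu.
Qed.

(** Choose n with g = f - u n nonzero. If g meets u n, then two copies of the
  meet fit into f, one below g and the other below f /\ u n, and its value is
  at most half of the value of f. *)
Lemma null_seq_halve u k e : null_seq u -> e <> ezero ->
  exists f, [/\ f <> ezero, (f <= e)%O &
    (exists n, (f `&` u n)%O = ezero) \/
    forall w, is_state w -> 2 ^+ k * w f <= w e].
Proof.
move=> nu e0; elim: k => [|k [f [f0 fe [|wf]]]].
- by exists e; split => //; right => w _; rewrite expr0 mul1r.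
- by exists f; split => //; left.
have [n fn0] := null_seq_ediff nu f0; set g := f :-: u n in fn0.
have [gn0|gn0] := pselect ((g `&` u n)%O = ezero).
  by exists g; split => //; [exact: le_trans (ediff_le _ _) fe|left; exists n].
have gf : (g `&` u n <= f)%O by apply: le_trans (leIl _ _) _; exact: ediff_le.
exists (g `&` u n)%O; split => //; first exact: le_trans fe.
right => w ws; apply: le_trans (wf w ws); rewrite exprSr -mulrA.
rewrite ler_pM2l ?exprn_gt0// mulr2n mulrDl !mul1r (state_ediff ws f (u n)).
rewrite lerD// state_le// ?leIl// lexI leIr andbT//.
Qed.

(** If f is so small that w(f) <= 2^-k, then f - u n, which is nonzero for some
  n, forces u n to be below f. *)
Lemma force_small u k e : null_seq u -> e <> ezero ->
  exists f, [/\ f <> ezero, (f <= e)%O &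
    exists n, forced f (fun w => 2 ^+ k * w (u n) <= 1)].
Proof.
move=> nu /(null_seq_halve k nu)[f [f0 fe [[n fn0]|wf]]].
  exists f; split => //; exists n => P w primeP nPf [ws wP].
  have [//|/wP ->] := prime_disjoint primeP fn0.
  by rewrite mulr0.
have [n fn0] := null_seq_ediff nu f0.
exists (f :-: u n); split => //; first exact: le_trans (ediff_le _ _) fe.
exists n => P w primeP nP [ws wP].
have [//|uf] := prime_disjoint primeP (ediff_disjoint f (u n)).
apply: le_trans (state_le1 ws e); apply: le_trans (wf _ ws).
by rewrite ler_pM2l ?exprn_gt0//; exact: state_lemod wP uf.
Qed.

(** Having countably many sequences in one condition makes a countable
  conjunction of generic properties generic. *)
Definition generic (S : (E -> R) -> Prop) := exists2 D : nat -> nat -> E,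
  (forall i, null_seq (D i)) &
  forall w, is_state w -> (forall i, w (D i n) @[n --> \oo] --> 0) -> S w.

(** The enumeration runs through all pairs (i, k); the condition reached at
  pair (i, k) forces 2^k w(D i n) <= 1 for some n. As b - a is disjoint from a
  - b, it lies in P, so w(a) - w(b) = w(a - b), which is positive. *)
Lemma generic_le a b : generic (fun w => w a <= w b) -> (a <= b)%O.
Proof.
move=> [D nullD Dab]; apply: contrapT => nab.
have c0 : a :-: b <> ezero by move/ediff_le0.
have [e0 [e0n0 e0c e0_pos]] := force_pos c0.
have /choice[next nextP] : forall p : E * (nat * nat), exists f,
    p.1 <> ezero -> [/\ f <> ezero, (f <= p.1)%O &
    exists n, forced f (fun w => 2 ^+ p.2.2 * w (D p.2.1 n) <= 1)].
  move=> [e [i k]]/=; have [->|en0] := pselect (e = ezero).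
    by exists ezero.
  by have [f fP] := force_small k (nullD i) en0; exists f.
pose req j : nat * nat := odflt (0, 0)%N (unpickle j).
pose e := fix e j := if j is j'.+1 then next (e j', req j') else e0.
have en0 j : e j <> ezero.
  by elim: j => //= j IH; have [] := nextP (e j, req j) IH.
have [P [primeP nPe]] : exists P : set E, prime_ideal P /\ forall n, ~ P (e n).
  by apply: prime_ideal_avoiding => // j; have [] := nextP (e j, req j) (en0 j).
have [w [ws wP]] := prime_ideal_state R primeP.
have w_to0 i : w (D i n) @[n --> \oo] --> 0.
  apply/cvgrPdist_le => eps eps0.
  have [k keps] : exists k, 2^-1 ^+ k <= eps.
    have /cvgrPdist_le/(_ _ eps0)[k _ /(_ k (leqnn k))] :=
      @cvg_expr R 2^-1 ltac:(by rewrite ger0_norm ?invr_ge0// invf_lt1// ltr1n).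
    by rewrite sub0r normrN ger0_norm ?exprn_ge0 ?invr_ge0// => ?; exists k.
  have [_ _ [n nforced]] := nextP (e (pickle (i, k)), (i, k)) (en0 _).
  have wn : 2 ^+ k * w (D i n) <= 1.
    apply: (nforced P w) => //; have := nPe (pickle (i, k)).+1.
    by rewrite /= /req pickleK.
  exists n => // m /= nm; rewrite sub0r normrN ger0_norm ?(state_ge0 ws)//.
  apply: le_trans keps; rewrite exprVn -[leRHS]mulr1 ler_pdivlMl ?exprn_gt0//.
  apply: le_trans wn; rewrite ler_pM2l ?exprn_gt0//; apply: state_le => //.
  rewrite -(subnK nm); elim: (m - n)%N => //= q; apply: le_trans.
  exact: (nullD i).1.
have := Dab _ ws w_to0; rewrite (state_ediff ws a b) (state_ediff ws b a) meetC.
rewrite lerD2l; have nPc : ~ P (a :-: b).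
  by move=> Pc; apply: (nPe 0%N); exact: (prime_le primeP) Pc.
have [//|/wP ->] := prime_disjoint primeP (ediff_disjoint a b).
by rewrite leNgt => /negP; apply; apply: (e0_pos P w) => //; exact: (nPe 0%N).
Qed.

Lemma generic_eq a b : generic (fun w => w a = w b) -> a = b.
Proof.
move=> [D nD wab]; apply/eqP; rewrite eq_le; apply/andP.
by split; apply: generic_le; exists D => // w ws wD; rewrite (wab w ws wD).
Qed.

Lemma generic_weaken (S T : (E -> R) -> Prop) :
  (forall w, is_state w -> S w -> T w) -> generic S -> generic T.
Proof.
by move=> ST [D nD DS]; exists D => // w ws wD; apply: ST => //; exact: DS.
Qed.

Lemma generic_state (S : (E -> R) -> Prop) :
  (forall w, is_state w -> S w) -> generic S.
Proof.
move=> wS; exists (fun _ _ => ezero); last by move=> w /wS.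
by split => // x /(_ 0%N) /le0_eq.
Qed.

Lemma generic_forall (S : nat -> (E -> R) -> Prop) :
  (forall i, generic (S i)) -> generic (fun w => forall i, S i w).
Proof.
move=> gS; have /choice[D DP] : forall i, exists D : nat -> nat -> E,
    (forall j, null_seq (D j)) /\ forall w, is_state w ->
      (forall j, w (D j n) @[n --> \oo] --> 0) -> S i w.
  by move=> i; have [D ? ?] := gS i; exists D.
pose D' k := let ij := odflt (0, 0)%N (unpickle k) in D ij.1 ij.2.
exists D' => [k|w ws wD i]; first exact: (DP _).1.
apply: (DP i).2 => // j; have := wD (pickle (i, j)).
by rewrite /D' pickleK.
Qed.

Lemma generic_and (S T : (E -> R) -> Prop) :
  generic S -> generic T -> generic (fun w => S w /\ T w).
Proof.
move=> gS gT.
have : generic (fun w => forall i : nat, (if i is 0%N then S else T) w).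
  by apply: generic_forall => -[].
by apply: generic_weaken => w _ wST; split; [exact: (wST 0%N)|exact: (wST 1%N)].
Qed.

(** The single requirement is that the differences a - u n, which decrease to
  0, have values converging to 0. *)
Lemma generic_cvg_sup u a : (forall n, (u n <= u n.+1)%O) ->
  supremums (range u) a -> generic (fun w => w (u n) @[n --> \oo] --> w a).
Proof.
move=> u_incr [ubu lubu]; have ua n : (u n <= a)%O by apply: ubu; exists n.
exists (fun _ n => a :-: u n) => [_|w ws /(_ 0%N) wu].
  split=> [n|x xu].
    by apply: ediff_anti; rewrite leI2.
  have /le_eadd[y xy] : (x <= a)%O by apply: le_trans (xu 0%N) (ediff_le _ _).
  rewrite eaddC in xy; suff ya : (a <= y)%O.
    by apply/le0_eq/(eadd_le_anti (eaddx0 a) xy).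
  apply: lubu => _ [n _ <-].
  have ux := ediffK (ua n); rewrite eaddC in ux; rewrite eaddC in xy.
  exact: eadd_le_anti xy ux (xu n).
rewrite (_ : (fun n => w (u n)) = (fun n => w a - w (a :-: u n))).
  by rewrite -[X in _ --> X]subr0; apply: cvgB => //; exact: cvg_cst.
apply/funext => n; rewrite (state_eadd ws (ediffK (ua n))).
by rewrite -addrA subrr addr0.
Qed.

Lemma generic_cvg_inf u a : (forall n, (u n.+1 <= u n)%O) ->
  infimums (range u) a -> generic (fun w => w (u n) @[n --> \oo] --> w a).
Proof.
move=> u_decr [lbu glbu]; have ua n : (a <= u n)%O by apply: lbu; exists n.
exists (fun _ n => u n :-: a) => [_|w ws /(_ 0%N) wu].
  split=> [n|x xu]; first exact: ediff_mono.
  have [s xs _] := eadd_le_mono (xu 0%N) (ediffK (ua 0%N)).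
  apply: (@eadd_eq0 _ _ a); rewrite xs; congr Some; apply/eqP.
  rewrite eq_le (eadd_le xs) andbT; apply: glbu => _ [n _ <-].
  by have [t] := eadd_le_mono (xu n) (ediffK (ua n)); rewrite xs => -[<-].
rewrite (_ : (fun n => w (u n)) = (fun n => w a + w (u n :-: a))).
  by rewrite -[X in _ --> X]addr0; apply: cvgD => //; exact: cvg_cst.
by apply/funext => n; rewrite (state_eadd ws (ediffK (ua n))).
Qed.

End generic_states.

(** * Probabilities on the line *)

Lemma borel_ray_induction (R : realType) (H : set (set R)) :
  H setT -> setSD_closed H -> ndseq_closed H ->
  (forall t, H `]-oo, t[%classic) ->
  forall A, measurable A -> H A.
Proof.
move=> HT HD Hnd Hray A mA.
have {mA} : (@measurable_realfun.RGenInftyO.G R).-sigma.-measurable A.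
  by rewrite -measurable_realfun.RGenInftyO.measurableE.
apply: lambda_system_subset => //; first last; first by move=> _ [t ->].
move=> _ _ [s ->] [t ->]; exists (Num.min s t).
by apply/seteqP; split=> x /=; rewrite !in_itv/= lt_min => /andP.
Qed.

Lemma probability_of_cdf (R : realType) (F : R -> R) (alpha beta : R) :
  nondecreasing F -> right_continuous F ->
  (forall t, t <= alpha -> F t = 0) -> (forall t, beta <= t -> F t = 1) ->
  exists P : probability (measurableTypeR R) R,
    forall t, P `]-oo, t]%classic = (F t)%:E.
Proof.
move=> ndF rcF F0 F1.
have FNy : F @ -oo --> (0 : R).
  apply: cvg_near_cst; near=> t; apply: F0; near: t.
  by apply: nbhs_ninfty_le; rewrite num_real.
have Fy : F @ +oo --> (1 : R).
  apply: cvg_near_cst; near=> t; apply: F1; near: t.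
  by apply: nbhs_pinfty_ge; rewrite num_real.
pose isC := isCumulative.Build R _ R F ndF rcF.
pose isB := isCumulativeBounded.Build R 0 1 F FNy Fy.
pose f : cumulativeBounded (0 : R) (1 : R) := HB.pack F isC isB.
exists (lebesgue_stieltjes_measure f) => t.
exact: cdf_lebesgue_stieltjes_id.
Unshelve. all: by end_near. Qed.

(** * The observable of a resolution *)

Record is_resolution (R : realType) d (E : effectAlgebraType d) (f : R -> E) :
    Prop := IsResolution {
  res_mono : forall s t, s <= t -> (f s <= f t)%O;
  res_left : forall t u, (forall s, s < t -> (f s <= u)%O) -> (f t <= u)%O;
  res_zero : exists alpha, f alpha = ezero;
  res_one : exists beta, f beta = eone
}.

Section observable_of_resolution.
Context (R : realType) d (E : sigmaMVEffectAlgebraType d).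
Context (f : R -> E) (fres : is_resolution f).
Implicit Types (w : E -> R) (s t : R) (a b : E).

(** The function w \o f is left continuous at a given point only for generic w.
  Its right limits, however, are right continuous for every state w, as a
  distribution function for closed rays has to be. *)
Definition right_limit w t := inf [set w (f s) | s in `]t, +oo[].

Lemma right_limit_le w s t : is_state w -> t < s -> right_limit w t <= w (f s).
Proof.
move=> ws ts; apply: ge_inf; first by exists 0 => _ [u _ <-]; exact: state_ge0.
by exists s => //=; rewrite in_itv/= ts.
Qed.

Lemma le_right_limit w t (x : R) :
  (forall s, t < s -> x <= w (f s)) -> x <= right_limit w t.
Proof.
move=> xw; apply: lb_le_inf.
  by exists (w (f (t + 1))), (t + 1) => //=; rewrite in_itv/= ltrDl ltr01.
by move=> _ [s /= + <-]; rewrite in_itv/= andbT; exact: xw.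
Qed.

Lemma right_limit_near w t (eps : R) : is_state w -> 0 < eps ->
  exists2 s, t < s & w (f s) < right_limit w t + eps.
Proof.
move=> ws eps0; apply: contrapT => noS.
suff : right_limit w t + eps <= right_limit w t by rewrite gerDl leNgt eps0.
apply: le_right_limit => s ts; rewrite leNgt; apply/negP => wfs.
by apply: noS; exists s.
Qed.

Lemma right_limit_nondecreasing w : is_state w -> nondecreasing (right_limit w).
Proof.
move=> ws s t st; apply: le_right_limit => u tu.
by apply: right_limit_le => //; exact: le_lt_trans tu.
Qed.

Lemma right_limit_right_continuous w : is_state w ->
  right_continuous (right_limit w).
Proof.
move=> ws t; apply/cvgrPdist_lt => eps eps0.
have [s ts wfs] := right_limit_near t ws eps0.
near=> u; have tu : t < u by near: u; exact: nbhs_right_gt.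
have us : u < s by near: u; exact: nbhs_right_lt.
rewrite distrC ger0_norm; last first.
  by rewrite subr_ge0; apply: right_limit_nondecreasing => //; exact: ltW.
by rewrite ltrBlDl (le_lt_trans _ wfs)// right_limit_le.
Unshelve. all: by end_near. Qed.

Lemma state_distribution w : is_state w ->
  exists P : probability (measurableTypeR R) R,
    forall t, P `]-oo, t]%classic = (right_limit w t)%:E.
Proof.
move=> ws; have [alpha falpha] := res_zero fres.
have [beta fbeta] := res_one fres.
apply: (@probability_of_cdf _ _ (alpha - 1) beta).
- exact: right_limit_nondecreasing.
- exact: right_limit_right_continuous.
- move=> t ta; apply/eqP; rewrite eq_le; apply/andP; split.
    rewrite -(state_zero ws) -falpha right_limit_le//.
    by rewrite (le_lt_trans ta)// ltrBlDr ltrDl.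
  by apply: le_right_limit => s _; exact: state_ge0.
- have f1 s : beta <= s -> f s = eone.
    by move=> bs; apply/eqP; rewrite eq_le elex1 -fbeta res_mono.
  move=> t bt; apply/eqP; rewrite eq_le; apply/andP; split.
    rewrite -(state_one ws) -(f1 (t + 1)) ?right_limit_le ?ltrDl//.
    by rewrite (le_trans bt)// lerDl.
  by apply: le_right_limit => s ts; rewrite f1 ?state_one// (le_trans bt)// ltW.
Qed.

(** The element a is the meet of f over a sequence decreasing to t, so that a
  single continuity requirement suffices. *)
Lemma generic_right_limit t : exists a,
  [/\ forall s, t < s -> (a <= f s)%O, forall s, s <= t -> (f s <= a)%O &
  generic (fun w => right_limit w t = w a)].
Proof.
pose u n := f (t + n.+1%:R^-1).
have u_decr n : (u n.+1 <= u n)%O.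
  by apply: res_mono fres _ _ _; rewrite lerD2l lef_pV2 ?posrE// ler_nat.
have [a infa] := @countable_meet _ E (range u) (card_image_le _ _).
have a_le s : t < s -> (a <= f s)%O.
  move=> /ltr_add_invr[n ns]; apply: (@le_trans _ _ (u n)).
    by apply: infa.1; exists n.
  by apply: res_mono fres _ _ _; exact: ltW.
exists a; split => //.
  move=> s st; apply: infa.2 => _ [n _ <-]; apply: res_mono fres _ _ _.
  by rewrite (le_trans st)// lerDl invr_ge0.
apply: generic_weaken (generic_cvg_inf R u_decr infa) => w ws wu.
apply/eqP; rewrite eq_le; apply/andP; split.
  rewrite -(cvg_lim _ wu)//; apply: limr_ge; first exact: cvgP wu.
  by apply: nearW => n; apply: right_limit_le => //; rewrite ltrDl invr_gt0.
by apply: le_right_limit => s ts; apply: state_le => //; exact: a_le.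
Qed.

Lemma distribution_exists :
  exists mu : (E -> R) -> probability (measurableTypeR R) R, forall w,
    is_state w -> forall t, mu w `]-oo, t]%classic = (right_limit w t)%:E.
Proof.
suff /choice[mu muP] : forall w, exists P : probability (measurableTypeR R) R,
    is_state w -> forall t, P `]-oo, t]%classic = (right_limit w t)%:E.
  by exists mu.
move=> w; have [ws|nws] := pselect (is_state w).
  by have [P PE] := state_distribution ws; exists P.
by exists (@dirac _ (measurableTypeR R) 0 R) => /nws.
Qed.

Context (mu : (E -> R) -> probability (measurableTypeR R) R).
Context (muE : forall w, is_state w ->
  forall t, mu w `]-oo, t]%classic = (right_limit w t)%:E).

Definition represents (A : set R) a := generic (fun w => mu w A = (w a)%:E).

(** The order of E is read off from the measures at generic states. It is what
  makes the difference of two representing elements a genuine one. *)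
Lemma represents_le (A B : set R) a b : measurable A -> measurable B ->
  A `<=` B -> represents A a -> represents B b -> (a <= b)%O.
Proof.
move=> mA mB AB Aa Bb; apply: (@generic_le R).
apply: generic_weaken (generic_and Aa Bb) => w ws [wa wb].
by rewrite -lee_fin -wa -wb le_measure// inE.
Qed.

Lemma represents_inj (A : set R) a b :
  represents A a -> represents A b -> a = b.
Proof.
move=> Aa Ab; apply: (@generic_eq R).
by apply: generic_weaken (generic_and Aa Ab) => w ws [->] [].
Qed.

Lemma represents_setT : represents setT eone.
Proof.
by apply: generic_state => w ws; rewrite probability_setT (state_one ws).
Qed.

Lemma represents_setD (A B : set R) a b : measurable A -> measurable B ->
  B `<=` A -> represents A a -> represents B b ->
  represents (A `\` B) (a :-: b).
Proof.
move=> mA mB BA Aa Bb; have ba : (b <= a)%O by exact: represents_le BA Bb Aa.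
apply: generic_weaken (generic_and Aa Bb) => w ws [wa wb].
have wab : w a = w b + w (a :-: b) by exact/(state_eadd ws)/ediffK.
have -> : w (a :-: b) = w a - w b by rewrite wab addrAC subrr add0r.
rewrite EFinB -wa -wb measureD// ?setIidr//.
by rewrite (le_lt_trans (probability_le1 _ _))// ltry.
Qed.

Lemma represents_bigcup (F : nat -> set R) u a : (forall n, measurable (F n)) ->
  (forall n, F n `<=` F n.+1) -> (forall n, represents (F n) (u n)) ->
  supremums (range u) a -> represents (\bigcup_n F n) a.
Proof.
move=> mF incF Fu supa.
have u_incr n : (u n <= u n.+1)%O.
  exact: represents_le (incF n) (Fu n) (Fu n.+1).
have gF := generic_forall Fu; have gu := generic_cvg_sup R u_incr supa.
apply: generic_weaken (generic_and gF gu) => w ws [wF wu].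
have cvgF : mu w \o F @ \oo --> mu w (\bigcup_n F n).
  apply: nondecreasing_cvg_mu => //; first exact: bigcupT_measurable.
  by apply/nondecreasing_seqP => n; apply/subsetPset.
apply: (cvg_unique _ cvgF) => //.
rewrite (_ : _ \o _ = EFin \o (w \o u)); last first.
  by apply/funext => n /=; rewrite wF.
apply: cvg_EFin; first exact: nearW.
exact: wu.
Qed.

Lemma represents_closed_ray t : exists a, [/\ forall s, t < s -> (a <= f s)%O,
  forall s, s <= t -> (f s <= a)%O & represents `]-oo, t]%classic a].
Proof.
have [a [a_le le_a ga]] := generic_right_limit t; exists a; split => //.
by apply: generic_weaken ga => w ws wa; rewrite muE// wa.
Qed.

(** The open ray is the union of the closed rays up to t - 1/(n + 1), and by
  left continuity of f the elements representing these have join f t. *)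
Lemma represents_open_ray t : represents `]-oo, t[%classic (f t).
Proof.
have /choice[a aP] n := represents_closed_ray (t - n.+1%:R^-1).
have tn n : t - n.+1%:R^-1 < t by rewrite ltrBlDr ltrDl invr_gt0.
have -> : `]-oo, t[%classic = \bigcup_n `]-oo, t - n.+1%:R^-1]%classic.
  apply/seteqP; split=> s /=; rewrite in_itv/=.
    move=> /ltr_add_invr[n ns]; exists n => //=.
    by rewrite in_itv/= lerBrDr ltW.
  by move=> [n _ /=]; rewrite in_itv/= => /le_lt_trans; exact.
apply: (@represents_bigcup _ a).
- by move=> n; exact: measurable_itv.
- move=> n; apply: subset_itvl; rewrite bnd_simp lerD2l lerN2.
  by rewrite lef_pV2 ?posrE// ler_nat.
- by move=> n; have [] := aP n.
- split=> [_ [n _ <-]|u ub]; first by have [+ _ _] := aP n; exact.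
  apply: res_left fres _ _ _ => s st; have [n ns] := ltr_add_invr st.
  apply: (@le_trans _ _ (a n)); last by apply: ub; exists n.
  by have [_ + _] := aP n; apply; rewrite lerBrDr ltW.
Qed.

Lemma represents_exists (A : set R) : measurable A -> exists a, represents A a.
Proof.
move=> mA; suff [//] : measurable A /\ exists a, represents A a.
apply: (@borel_ray_induction R
  (fun A => measurable A /\ exists a, represents A a)).
- by split; [exact: measurableT|exists eone; exact: represents_setT].
- move=> B C CB [mB [b Bb]] [mC [c Cc]]; split; first exact: measurableD.
  by exists (b :-: c); exact: represents_setD.
- move=> F ndF FP; have mF n := (FP n).1; have /choice[u Fu] n := (FP n).2.
  split; first exact: bigcupT_measurable.
  have [a supa] := @countable_join _ E (range u) (card_image_le _ _).
  exists a; apply: represents_bigcup Fu supa => // n.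
  by apply/subsetPset; apply: ndF.
- move=> t; split; first exact: measurable_itv.
  by exists (f t); exact: represents_open_ray.
- exact: mA.
Qed.

Definition representative (A : borel R) : E :=
  xget ezero [set a | represents A a].

Lemma representativeP (A : borel R) : represents A (representative A).
Proof.
have [a Aa] := represents_exists (borel_measurable A).
by rewrite /representative; case: xgetP => // /(_ a).
Qed.

Lemma representative_is_observable : is_observable representative.
Proof.
split.
- move=> A AT; apply: (@represents_inj A); first exact: representativeP.
  by rewrite AT; exact: represents_setT.
- move=> A B C AB0 ABC; have mA := borel_measurable A.
  have mC := borel_measurable C.
  have AC : A `<=` C by rewrite -ABC; exact: subsetUl.
  have ac := represents_le mA mC AC (representativeP A) (representativeP C).
  rewrite -(ediffK ac); congr eadd; apply: (@represents_inj B).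
    exact: representativeP.
  rewrite (_ : (B : set R) = C `\` A).
    by apply: represents_setD => //; exact: representativeP.
  by rewrite -ABC setDUl setDv set0U setDidl// setIC.
- move=> F A incF FA; pose u i := representative (F i).
  have mF i := borel_measurable (F i).
  have [a supa] := @countable_join _ E (range u) (card_image_le _ _).
  suff -> : representative A = a by [].
  apply: (@represents_inj A); first exact: representativeP.
  rewrite -FA; apply: represents_bigcup supa => // i; exact: representativeP.
Qed.

End observable_of_resolution.

(** * Observables and their spectral resolutions *)

Section observable_theory.
Context (R : realType) d (E : mvEffectAlgebraType d).
Implicit Types (x y : observable R E) (A B : borel R) (s t : R).

Lemma obs_le x A B : A `<=` B -> (x A <= x B)%O.
Proof.
move=> AB.
pose C := Borel (measurableD (borel_measurable B) (borel_measurable A)).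
have := @obs_add _ _ _ _ (observableP x) A C B.
move=> /(_ _ _)/eadd_le; apply; first by rewrite setDIK.
by rewrite setDUK.
Qed.

Lemma borel_eq A B : A = B :> set R -> A = B.
Proof.
case: A B => [A mA] [B mB] /= AB; rewrite AB in mA *.
by congr Borel; exact: Prop_irrelevance.
Qed.

Lemma spectral_resolution_inj x y :
  spectral_resolution x = spectral_resolution y -> x = y.
Proof.
move=> xy; suff: forall A, x A = y A.
  case: x y {xy} => [x xP] [y yP] /= /funext xy; rewrite xy in xP *.
  by congr Observable; exact: Prop_irrelevance.
pose H (A : set R) := exists mA : measurable A, x (Borel mA) = y (Borel mA).
have xyH A : H A -> x A = y A.
  by case=> mA xyA; have -> : A = Borel mA by exact: borel_eq.
move=> A; apply: (xyH); apply: borel_ray_induction (borel_measurable A).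
- exists measurableT; rewrite !(obs_setT (observableP _))//.
- move=> B C CB [mB xyB] [mC xyC]; exists (measurableD mB mC).
  have add (z : observable R E) :
      eadd (z (Borel mC)) (z (Borel (measurableD mB mC))) = Some (z (Borel mB)).
    by apply: (@obs_add _ _ _ _ (observableP z) (Borel mC)) => /=;
      [rewrite setDIK|rewrite setDUK].
  have := add x; rewrite xyB xyC => xD.
  exact: eadd_inj xD (add y).
- move=> F ndF FH; have mF n : measurable (F n) by case: (FH n).
  have mU : measurable (\bigcup_n F n) by exact: bigcupT_measurable.
  exists mU.
  have incF n : F n `<=` F n.+1 by apply/subsetPset; exact: ndF.
  have sup (z : observable R E) := @obs_sup _ _ _ _ (observableP z)
    (fun n => Borel (mF n)) (Borel mU) incF erefl.
  apply: is_subset1_supremums (sup x) _.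
  rewrite (_ : (fun n => x _) = (fun n => y (Borel (mF n)))); first exact: sup.
  by apply/funext => n; exact: (xyH (Borel (mF n)) (FH n)).
- move=> t; exists (measurable_itv _).
  by have := congr1 (@^~ t) xy.
Qed.

Lemma spectral_le x s t : s <= t ->
  (spectral_resolution x s <= spectral_resolution x t)%O.
Proof.
by move=> st; apply: obs_le => /=; apply: subset_itvl; rewrite bnd_simp.
Qed.

Lemma spectral_is_resolution x : bounded_observable x ->
  is_resolution (spectral_resolution x).
Proof.
move=> [alpha [beta xab]]; split.
- exact: spectral_le.
- move=> t u us.
  pose F n := Borel (measurable_itv `]-oo, t - n.+1%:R^-1[).
  have incF n : F n `<=` F n.+1.
    apply: subset_itvl; rewrite bnd_simp lerD2l lerN2.
    by rewrite lef_pV2 ?posrE// ler_nat.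
  have UF : \bigcup_n F n = Borel (measurable_itv `]-oo, t[).
    apply/seteqP; split=> s /=; rewrite ?in_itv/=.
      move=> [n _ /=]; rewrite in_itv/= => /lt_le_trans; apply.
      by rewrite lerBlDr lerDl invr_ge0.
    by move=> /ltr_add_invr[n ns]; exists n => //=; rewrite in_itv/= ltrBrDr.
  have [_] := obs_sup (observableP x) incF UF; apply => _ [n _ <-].
  by apply: us; rewrite ltrBlDr ltrDl invr_gt0.
- exists alpha; pose A := Borel (measurable_itv `]-oo, alpha[).
  pose B := Borel (measurable_itv `[alpha, beta]).
  pose C := Borel (measurableU _ _ (borel_measurable A) (borel_measurable B)).
  apply: eadd_one; rewrite -xab.
  have -> // := @obs_add _ _ _ _ (observableP x) A B C _ erefl.
  apply/seteqP; split=> s //= []; rewrite !in_itv/= => sa /andP[].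
  by rewrite leNgt sa.
- exists (beta + 1); apply/eqP; rewrite eq_le elex1/= -xab; apply: obs_le.
  move=> s /=; rewrite !in_itv/= => /andP[_ /le_lt_trans]; apply.
  by rewrite ltrDl.
Qed.

(** As the ray below alpha has value 0, removing it from the ray below beta
  does not change the value 1. *)
Lemma resolution_bounded x : is_resolution (spectral_resolution x) ->
  bounded_observable x.
Proof.
move=> xres; have [alpha xa] := res_zero xres; have [beta xb] := res_one xres.
exists alpha, beta; pose A := Borel (measurable_itv `]-oo, alpha[).
pose B := Borel (measurable_itv `[alpha, beta]).
pose C := Borel (measurableU _ _ (borel_measurable A) (borel_measurable B)).
have AB0 : A `&` B = set0.
  apply/seteqP; split=> s //= []; rewrite !in_itv/= => sa /andP[].
  by rewrite leNgt sa.
have := @obs_add _ _ _ _ (observableP x) A B C AB0 erefl.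
rewrite [x A]xa eadd0x => -[->]; apply/eqP; rewrite eq_le elex1/= -xb.
apply: obs_le => s /=; rewrite !in_itv/= => sb.
by have [sa|sa] := ltP s alpha; [left|right; rewrite (ltW sb)].
Qed.

End observable_theory.

Lemma resolution_observable (R : realType) d (E : sigmaMVEffectAlgebraType d)
    (f : R -> E) : is_resolution f ->
  exists2 x : observable R E, bounded_observable x & spectral_resolution x = f.
Proof.
move=> fres; have [mu muE] := distribution_exists fres.
pose x := Observable (representative_is_observable fres muE).
have xf : spectral_resolution x = f.
  apply/funext => t; apply: represents_inj (representativeP fres muE _) _.
  exact: represents_open_ray.
by exists x => //; apply: resolution_bounded; rewrite xf.
Qed.

(** * The sum of observables *)

Section sum_of_observables.
Context (R : realType) d (E : sigmaMVEffectAlgebraType d).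
Implicit Types (x y z : observable R E) (f g h k : R -> E) (t : R) (a u : E).

Local Notation B := spectral_resolution.

Definition meets_at f g t : set E := range (fun r => f r `&` g (t - r))%O.

Lemma res_supremums f t : is_resolution f ->
  supremums [set f s | s in `]-oo, t[] (f t).
Proof.
move=> fres; split=> [_ [s /= + <-]|u fu].
  by rewrite in_itv/= => /ltW; exact: res_mono.
by apply: (res_left fres) => s st; apply: fu; exists s.
Qed.

Lemma meet_res_le f t a u : is_resolution f ->
  (forall s, s < t -> (a `&` f s <= u)%O) -> (a `&` f t <= u)%O.
Proof.
move=> fres au; have [_] := meet_supremums a (res_supremums t fres).
apply => _ [_ [s + <-] <-]; rewrite /= in_itv/=; exact: au.
Qed.

(** A real r can be decreased to a rational q: this increases g (t - q), and f
  r is the join of the values of f below r. For bounded observables the sum may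
  thus be computed with real indices, which the substitution r |-> t - r
  permutes. *)
Lemma ubound_rat_meets f g t : is_resolution f -> is_resolution g ->
  ubound (range (fun r : rat => f (ratr r) `&` g (t - ratr r))%O) =
  ubound (meets_at f g t).
Proof.
move=> fres gres; apply/seteqP; split=> u ubu; last first.
  by move=> _ [r _ <-]; apply: ubu; exists (ratr r).
move=> _ [r _ <-]; rewrite meetC; apply: meet_res_le => // s sr.
have [q] := rat_in_itvoo sr; rewrite in_itv/= => /andP[sq qr].
apply: (@le_trans _ _ (f (ratr q) `&` g (t - ratr q))%O); last first.
  by apply: ubu; exists q.
by rewrite meetC leI2// res_mono ?(ltW sq)// lerD2l lerN2 ltW.
Qed.

Lemma meets_at_resolution f g h : is_resolution f -> is_resolution g ->
  (forall t, supremums (meets_at f g t) (h t)) -> is_resolution h.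
Proof.
move=> fres gres hsup; have hub r t : (f r `&` g (t - r) <= h t)%O.
  by apply: (hsup t).1; exists r.
split.
- move=> s t st; apply: (hsup s).2 => _ [r _ <-].
  by apply: le_trans (hub r t); rewrite leI2// res_mono// lerD2r.
- move=> t u hu; apply: (hsup t).2 => _ [r _ <-].
  apply: meet_res_le => // s str.
  apply: (le_trans _ (hu (s + r) _)); last by rewrite -ltrBrDr.
  by have := hub r (s + r); rewrite addrK.
- have [alpha fa] := res_zero fres; have [beta gb] := res_zero gres.
  exists (alpha + beta); apply: le0_eq; apply: (hsup _).2 => _ [r _ <-].
  have [ra|ar] := leP r alpha.
    by rewrite (le_trans (leIl _ _))// -fa res_mono.
  rewrite (le_trans (leIr _ _))// -gb res_mono//.
  by rewrite lerBlDr addrC lerD2l ltW.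
- have [alpha fa] := res_one fres; have [beta gb] := res_one gres.
  exists (alpha + beta); apply/eqP; rewrite eq_le elex1/=.
  have := hub alpha (alpha + beta); rewrite addrAC subrr add0r fa gb.
  by rewrite meetxx.
Qed.

Lemma is_obs_sumE x y (s : observable R E) :
  bounded_observable x -> bounded_observable y ->
  is_obs_sum x y s <-> bounded_observable s /\ forall t,
    supremums (meets_at (B x) (B y) t)
      (B s t).
Proof.
move=> /spectral_is_resolution xres /spectral_is_resolution yres.
by split=> -[sb sup]; split => // t; have := sup t;
  rewrite /supremums (ubound_rat_meets t xres yres).
Qed.

Lemma obs_sumP x y : bounded_observable x -> bounded_observable y ->
  bounded_observable (obs_sum x y) /\ forall t,
    supremums (meets_at (B x) (B y) t)
      (B (obs_sum x y) t).
Proof.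
move=> xb yb; apply/is_obs_sumE => //; apply: xgetPex.
have xres := spectral_is_resolution xb; have yres := spectral_is_resolution yb.
have /choice[h hsup] t : exists a, supremums
    (meets_at (B x) (B y) t) a.
  rewrite /supremums -(ubound_rat_meets t xres yres).
  apply: countable_join; apply: card_le_trans (countableP [set: rat]).
  exact: card_image_le.
have [s sb sh] := resolution_observable (meets_at_resolution xres yres hsup).
by exists s; apply/is_obs_sumE => //; rewrite sh.
Qed.

Lemma obs_sum_unique x y (s : observable R E) :
  bounded_observable x -> bounded_observable y ->
  bounded_observable s ->
  (forall t, ubound (meets_at (B x) (B y) t) =
    ubound [set B s t]) ->
  obs_sum x y = s.
Proof.
move=> xb yb sb ubE; have [_ sup] := obs_sumP xb yb.
apply: spectral_resolution_inj; apply/funext => t.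
apply: is_subset1_supremums (sup t) _.
by rewrite /supremums ubE -/(supremums _) supremums1.
Qed.

Lemma ubound_obs_sum x y t : bounded_observable x -> bounded_observable y ->
  ubound (meets_at (B x) (B y) t) =
  ubound [set B (obs_sum x y) t].
Proof.
move=> xb yb; have [_ /(_ t)[ub lub]] := obs_sumP xb yb.
apply/seteqP; split=> u uu; first by move=> _ ->; exact: lub.
by move=> a /ub /le_trans; apply; exact: uu.
Qed.

Lemma obs_sumC x y : bounded_observable x -> bounded_observable y ->
  obs_sum x y = obs_sum y x.
Proof.
move=> xb yb; apply: obs_sum_unique => // [|t]; first exact: (obs_sumP yb xb).1.
rewrite -ubound_obs_sum//; congr ubound; apply/seteqP.
by split=> _ [r _ <-]; exists (t - r) => //; rewrite subKr meetC.
Qed.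

Lemma ubound_obs_sum3 x y z t : bounded_observable x -> bounded_observable y ->
  bounded_observable z ->
  ubound (meets_at (B (obs_sum x y)) (B z) t) =
  ubound [set a | exists p q r, p + q + r = t /\ a = (B x p `&`
    B y q `&` B z r)%O].
Proof.
move=> xb yb zb; have [_ sup] := obs_sumP xb yb.
apply/seteqP; split=> u ubu.
  move=> _ [p [q [r [pqr ->]]]].
  apply: le_trans (ubu _ (ex_intro2 _ _ (p + q) I erefl)).
  rewrite -pqr [p + q + r - _]addrAC subrr add0r leI2//.
  by apply: (sup _).1; exists p => //; rewrite addrAC subrr add0r.
move=> _ [s _ <-]; rewrite meetC.
have [_] := meet_supremums (B z (t - s)) (sup s).
apply => _ [_ [p _ <-] <-]; apply: ubu; exists p, (s - p), (t - s).
by rewrite [p + _]addrC subrK addrC subrK meetC.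
Qed.

(** The bound set of three resolutions is invariant under cyclic permutation;
  with commutativity this gives associativity. *)
Lemma obs_sum_rotate x y z : bounded_observable x -> bounded_observable y ->
  bounded_observable z -> obs_sum (obs_sum x y) z = obs_sum (obs_sum y z) x.
Proof.
move=> xb yb zb; have xyb := (obs_sumP xb yb).1; have yzb := (obs_sumP yb zb).1.
apply: obs_sum_unique => // [|t]; first exact: (obs_sumP yzb xb).1.
rewrite -ubound_obs_sum// !ubound_obs_sum3//; congr ubound; apply/seteqP; split.
  move=> _ [p [q [r [<- ->]]]]; exists q, r, p.
  by split; [rewrite addrC addrA|rewrite -meetA meetC].
move=> _ [q [r [p [<- ->]]]]; exists p, q, r.
by split; [rewrite -addrA addrC|rewrite meetC meetA].
Qed.

Lemma obs_sumA x y z : bounded_observable x -> bounded_observable y ->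
  bounded_observable z -> obs_sum (obs_sum x y) z = obs_sum x (obs_sum y z).
Proof.
move=> xb yb zb; rewrite obs_sum_rotate// obs_sumC//.
exact: (obs_sumP yb zb).1.
Qed.

Lemma bounded_question a : bounded_observable (question R a).
Proof.
exists 0, 1; rewrite /question/= /question_fun.
by rewrite !mem_set//= in_itv/= ?lexx ler01.
Qed.

Lemma spectral_question0 t :
  B (question R (ezero : E)) t = if 0 < t then eone else ezero.
Proof.
rewrite /spectral_resolution /question/= /question_fun !mem_setE /= !in_itv/=.
rewrite eortho_zero; case: ifPn => [t1|_]; last by [].
by rewrite (lt_trans _ t1).
Qed.

Lemma obs_sumx0 x : bounded_observable x -> obs_sum x (question R ezero) = x.
Proof.
move=> xb; apply: obs_sum_unique => //; first exact: bounded_question.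
move=> t; apply/seteqP; split=> u ubu.
  move=> _ ->; apply: res_left (spectral_is_resolution xb) _ _ _ => s st.
  have := ubu _ (ex_intro2 _ _ s I erefl).
  by rewrite spectral_question0 subr_gt0 st (meet_l (elex1 _)).
move=> _ [r _ <-]; rewrite spectral_question0 subr_gt0; case: ifPn => [rt|_].
  rewrite (le_trans (leIl _ _))// (le_trans _ (ubu _ erefl))//.
  by apply: spectral_le; exact: ltW.
by rewrite (le_trans (leIr _ _))// ele0x.
Qed.

End sum_of_observables.

Theorem proposition3p5 (R : realType) (d : Order.disp_t)
    (E : sigmaMVEffectAlgebraType d) (x y z : observable R E)
    (hx : bounded_observable x) (hy : bounded_observable y)
    (hz : bounded_observable z) :
  [/\ obs_sum x y = obs_sum y x,
      obs_sum (obs_sum x y) z = obs_sum x (obs_sum y z),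
      obs_sum x (question R ezero) = x
    & obs_sum (question R ezero) x = x].
Proof.
split; [exact: obs_sumC|exact: obs_sumA|exact: obs_sumx0|].
by rewrite obs_sumC ?obs_sumx0//; exact: bounded_question.
Qed.
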